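(* For every positive integer $k$ (with $k\geq 2$ in the case of family (A)), the following are all congruent numbers: (A) (A1) $k(k^2-1)$; (A2) $2k(k^2+1)$; (A3) $k^4-1$ (for $k\ge 2$). (B) (B1) $2k(2k+1)(4k+1)$; (B2) $k(2k+1)(8k^2+4k+1)$; (B3) $(4k+1)(8k^2+4k+1)$. (C) (C1) $k(k+1)(2k+1)$; (C2) $2k(k+1)(2k^2+2k+1)$; (C3) $(2k+1)(2k^2+2k+1)$. (D) (D1) $2(k+1)(2k+1)(4k+3)$; (D2) $(k+1)(2k+1)(8k^2+12k+5)$; (D3) $(4k+3)(8k^2+12k+5)$. (E) (E1) $2k(2k+1)(2k-1)$; (E2) $k(4k^2+1)$; (E3) $(2k-1)(2k+1)(4k^2+1)$. (F) (F1) $k(4k+1)(8k+1)$; (F2) $2k(4k+1)(32k^2+8k+1)$; (F3) $(8k+1)(32k^2+8k+1)$. (G) (G1) $2(2k+1)(4k+1)(8k+3)$; (G2) $(8k+3)(32k^2+24k+5)$; (G3) $(2k+1)(4k+1)(32k^2+24k+5)$.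
   Context: A positive rational number $r$ is called a congruent number if there exist positive rational numbers $u,v,w$ with $u^2+v^2=w^2$ and $\frac{1}{2}uv=r$. Congruent numbers are not required to be square-free. *)

(* Defs.v *)
From mathcomp Require Import all_boot all_order all_algebra.
Set Implicit Arguments.
Unset Strict Implicit.
Unset Printing Implicit Defensive.
Import Order.TTheory GRing.Theory Num.Theory.
Local Open Scope ring_scope.

(* Square-freeness and integrality of r are deliberately not required. *)
Definition congruent_number (r : rat) : Prop :=
  0 < r /\
  exists u v w : rat,
    [/\ 0 < u, 0 < v & 0 < w] /\
    u ^+ 2 + v ^+ 2 = w ^+ 2 /\ 1 / 2 * u * v = r.

(* Main.v *)
Require Import Defs.
From mathcomp Require Import all_boot all_order all_algebra.
From mathcomp Require Import ring lra.
Import Order.TTheory GRing.Theory Num.Theory.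
Local Open Scope ring_scope.


(** Two rationals 0 < q < p generate the Pythagorean triple
    (p^2 - q^2, 2pq, p^2 + q^2), of area pq(p^2 - q^2).  Replacing (p, q) by
    (p^2 + q^2, 2pq) and by (p^2, q^2) produces two more areas, which are
    2pq(p^2 + q^2) and p^4 - q^4 up to the square factors (p^2 - q^2)^2 and
    (pq)^2.  Scaling a triangle by 1 / s divides its area by s^2, so square
    factors can be dropped, and one pair (p, q) yields three congruent numbers
    ([congruent_number_triple]).  Each family of the theorem consists of such a
    triple, some members being divided by 2^2; the pairs (p, q) are, in order,
    (k, 1), (2k + 1, 2k), (k + 1, k), (2k + 2, 2k + 1), (2k, 1),
    (4k + 1, 4k) and (4k + 2, 4k + 1). *)

Lemma congruent_number_div_sqr (s r t : rat) :
  0 < s -> t = s ^+ 2 * r ->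
  congruent_number t -> congruent_number r.
Proof.
move=> s_gt0 -> [t_gt0 [u [v [w [[u_gt0 v_gt0 w_gt0] [uvw area]]]]]].
have s_neq0 : s != 0 by rewrite gt_eqF.
split; first by rewrite -(pmulr_rgt0 _ (exprn_gt0 2 s_gt0)).
exists (u / s), (v / s), (w / s); split; first by split; apply: divr_gt0.
split; first by rewrite !expr_div_n -mulrDl uvw.
have -> : 1 / 2 * (u / s) * (v / s) = (1 / 2 * u * v) / s ^+ 2 by field.
by rewrite area mulrAC divff ?mul1r // expf_neq0.
Qed.

Lemma congruent_number_area (p q : rat) :
  0 < q -> q < p -> congruent_number (p * q * (p ^+ 2 - q ^+ 2)).
Proof.
move=> q_gt0 q_lt_p; have p_gt0 := lt_trans q_gt0 q_lt_p.
have d_gt0 : 0 < p ^+ 2 - q ^+ 2.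
  by rewrite subr_sqr mulr_gt0 ?subr_gt0 ?addr_gt0.
split; first by rewrite !mulr_gt0.
exists (p ^+ 2 - q ^+ 2), (2 * p * q), (p ^+ 2 + q ^+ 2).
split; first by split; rewrite ?d_gt0 ?mulr_gt0 ?addr_gt0 ?exprn_gt0.
by split; [ring | field].
Qed.

Lemma congruent_number_triple (p q : rat) : 0 < q -> q < p ->
  [/\ congruent_number (p * q * (p ^+ 2 - q ^+ 2)),
      congruent_number (2 * p * q * (p ^+ 2 + q ^+ 2))
    & congruent_number (p ^+ 4 - q ^+ 4)].
Proof.
move=> q_gt0 q_lt_p; have p_gt0 := lt_trans q_gt0 q_lt_p.
have d_gt0 : 0 < p ^+ 2 - q ^+ 2.
  by rewrite subr_sqr mulr_gt0 ?subr_gt0 ?addr_gt0.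
split; first exact: congruent_number_area.
- apply: (@congruent_number_div_sqr (p ^+ 2 - q ^+ 2) _ _ d_gt0 _
    (@congruent_number_area (p ^+ 2 + q ^+ 2) (2 * p * q) _ _)).
  + by ring.
  + by rewrite !mulr_gt0.
  + (* p^2 + q^2 - 2pq = (p - q)^2 *)
    rewrite -subr_gt0; have -> : p ^+ 2 + q ^+ 2 - 2 * p * q = (p - q) ^+ 2.
      by ring.
    by rewrite exprn_gt0 ?subr_gt0.
- apply: (@congruent_number_div_sqr (p * q) _ _ (mulr_gt0 p_gt0 q_gt0) _
    (@congruent_number_area (p ^+ 2) (q ^+ 2) _ _)).
  + by ring.
  + by rewrite exprn_gt0.
  + by rewrite -subr_gt0.
Qed.

Theorem theorem4p7 (n : nat) (hn : (1 <= n)%N) :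
  let k : rat := n%:R in
  (* A *)
  ((2 <= n)%N ->
    [/\ congruent_number (k * (k ^+ 2 - 1)),
        congruent_number (2 * k * (k ^+ 2 + 1))
      & congruent_number (k ^+ 4 - 1)]) /\
  (* B *)
  [/\ congruent_number (2 * k * (2 * k + 1) * (4 * k + 1)),
      congruent_number (k * (2 * k + 1) * (8 * k ^+ 2 + 4 * k + 1))
    & congruent_number ((4 * k + 1) * (8 * k ^+ 2 + 4 * k + 1))] /\
  (* C *)
  [/\ congruent_number (k * (k + 1) * (2 * k + 1)),
      congruent_number (2 * k * (k + 1) * (2 * k ^+ 2 + 2 * k + 1))
    & congruent_number ((2 * k + 1) * (2 * k ^+ 2 + 2 * k + 1))] /\
  (* D *)
  [/\ congruent_number (2 * (k + 1) * (2 * k + 1) * (4 * k + 3)),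
      congruent_number ((k + 1) * (2 * k + 1) * (8 * k ^+ 2 + 12 * k + 5))
    & congruent_number ((4 * k + 3) * (8 * k ^+ 2 + 12 * k + 5))] /\
  (* E *)
  [/\ congruent_number (2 * k * (2 * k + 1) * (2 * k - 1)),
      congruent_number (k * (4 * k ^+ 2 + 1))
    & congruent_number ((2 * k - 1) * (2 * k + 1) * (4 * k ^+ 2 + 1))] /\
  (* F *)
  [/\ congruent_number (k * (4 * k + 1) * (8 * k + 1)),
      congruent_number (2 * k * (4 * k + 1) * (32 * k ^+ 2 + 8 * k + 1))
    & congruent_number ((8 * k + 1) * (32 * k ^+ 2 + 8 * k + 1))] /\
  (* G *)
  [/\ congruent_number (2 * (2 * k + 1) * (4 * k + 1) * (8 * k + 3)),
      congruent_number ((8 * k + 3) * (32 * k ^+ 2 + 24 * k + 5))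
    & congruent_number
        ((2 * k + 1) * (4 * k + 1) * (32 * k ^+ 2 + 24 * k + 5))].
Proof.
move=> k; have k_ge1 : 1 <= k by rewrite /k ler1n.
split.
  move=> n_ge2; have k_ge2 : 2 <= k by rewrite /k ler_nat.
  have [a b c] := @congruent_number_triple k 1 ltac:(lra) ltac:(lra).
  split.
  - by apply: (@congruent_number_div_sqr 1 _ _ _ _ a) => //; ring.
  - by apply: (@congruent_number_div_sqr 1 _ _ _ _ b) => //; ring.
  - by apply: (@congruent_number_div_sqr 1 _ _ _ _ c) => //; ring.
split.
  have [a b c] := @congruent_number_triple (2 * k + 1) (2 * k)
    ltac:(lra) ltac:(lra).
  split.
  - by apply: (@congruent_number_div_sqr 1 _ _ _ _ a) => //; ring.
  - by apply: (@congruent_number_div_sqr 2 _ _ _ _ b) => //; ring.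
  - by apply: (@congruent_number_div_sqr 1 _ _ _ _ c) => //; ring.
split.
  have [a b c] := @congruent_number_triple (k + 1) k ltac:(lra) ltac:(lra).
  split.
  - by apply: (@congruent_number_div_sqr 1 _ _ _ _ a) => //; ring.
  - by apply: (@congruent_number_div_sqr 1 _ _ _ _ b) => //; ring.
  - by apply: (@congruent_number_div_sqr 1 _ _ _ _ c) => //; ring.
split.
  have [a b c] := @congruent_number_triple (2 * k + 2) (2 * k + 1)
    ltac:(lra) ltac:(lra).
  split.
  - by apply: (@congruent_number_div_sqr 1 _ _ _ _ a) => //; ring.
  - by apply: (@congruent_number_div_sqr 2 _ _ _ _ b) => //; ring.
  - by apply: (@congruent_number_div_sqr 1 _ _ _ _ c) => //; ring.
split.
  have [a b c] := @congruent_number_triple (2 * k) 1 ltac:(lra) ltac:(lra).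
  split.
  - by apply: (@congruent_number_div_sqr 1 _ _ _ _ a) => //; ring.
  - by apply: (@congruent_number_div_sqr 2 _ _ _ _ b) => //; ring.
  - by apply: (@congruent_number_div_sqr 1 _ _ _ _ c) => //; ring.
split.
  have [a b c] := @congruent_number_triple (4 * k + 1) (4 * k)
    ltac:(lra) ltac:(lra).
  split.
  - by apply: (@congruent_number_div_sqr 2 _ _ _ _ a) => //; ring.
  - by apply: (@congruent_number_div_sqr 2 _ _ _ _ b) => //; ring.
  - by apply: (@congruent_number_div_sqr 1 _ _ _ _ c) => //; ring.
(* Here the areas p^4 - q^4 and 2pq(p^2 + q^2) come in the opposite order. *)
have [a b c] := @congruent_number_triple (4 * k + 2) (4 * k + 1)
    ltac:(lra) ltac:(lra).
split.
- by apply: (@congruent_number_div_sqr 1 _ _ _ _ a) => //; ring.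
- by apply: (@congruent_number_div_sqr 1 _ _ _ _ c) => //; ring.
- by apply: (@congruent_number_div_sqr 2 _ _ _ _ b) => //; ring.
Qed.
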